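(* Let $r>1$ be an integer. The group $S_{r,1}=F_r/[F_r,F_r]=F_r/F_r^{(1)}\cong\mathbb{Z}^r$ does not have the $R_\infty$ property. On the other hand, the groups $S_{r,k}=F_r/F_r^{(k)}$ have property $R_\infty$ for all $k\geq 2$.
   Context: For a group $G$ and an endomorphism $\varphi$ of $G$, elements $x,y\in G$ are Reidemeister equivalent if there is $z\in G$ with $x=zy\varphi(z)^{-1}$. The Reidemeister number $R(\varphi)\in\{1,2,3,\ldots\}\cup\{\infty\}$ is the number of equivalence classes. A group $G$ has property $R_\infty$ if $R(\varphi)=\infty$ for every automorphism $\varphi$ of $G$. $F_r$ is the free group on $r$ generators. For a group $G$, the derived series is $G^{(0)}=G$, $G^{(i+1)}=[G^{(i)},G^{(i)}]$. $S_{r,k}$ is the free solvable group of rank $r$ and derived length $k$. *)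

(* Defs.v *)
From HB Require Import structures.
From mathcomp Require Import all_boot all_order all_algebra.
From mathcomp Require Import finmap.
From mathcomp Require Import boolp classical_sets functions cardinality.
From mathcomp Require Import constructive_ereal.

Set Implicit Arguments.
Unset Strict Implicit.
Unset Printing Implicit Defensive.

Local Open Scope classical_set_scope.
Local Open Scope group_scope.

(* Free groups are realized by reduced words: the letter (x, true) stands for
   the generator x and (x, false) for its inverse. *)
Section FreeGroup.
Variable X : choiceType.
Implicit Types (a b : X * bool) (u v w : seq (X * bool)).

Definition inv_letter a : X * bool := (a.1, ~~ a.2).

Definition reduced w : bool := sorted (fun a b => b != inv_letter a) w.

Definition cons_reduce a w :=
  if w is b :: w' then if b == inv_letter a then w' else a :: w else [:: a].

Definition mul_words u v := foldr cons_reduce v u.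

Definition inv_word w := rev [seq inv_letter a | a <- w].

Record free_group := FreeGroupElt { word : seq (X * bool); _ : reduced word }.

HB.instance Definition _ := [isSub for word].
HB.instance Definition _ := [Choice of free_group by <:].

Lemma inv_letterK : involutive inv_letter.
Proof. by case=> x e; rewrite /inv_letter /= negbK. Qed.

Lemma reduced_cons a w :
  reduced (a :: w) = (if w is b :: _ then b != inv_letter a else true) && reduced w.
Proof. by case: w. Qed.

Lemma reduced_cons_reduce a w : reduced w -> reduced (cons_reduce a w).
Proof.
case: w => [|b w] // rw; rewrite /cons_reduce; case: ifPn => [_|nba].
  by move: rw; rewrite reduced_cons => /andP[].
by rewrite reduced_cons nba.
Qed.

Lemma reduced_mul u v : reduced v -> reduced (mul_words u v).
Proof. by move=> rv; elim: u => //= a u; exact: reduced_cons_reduce. Qed.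

Lemma cons_reduceK a w :
  reduced w -> cons_reduce a (cons_reduce (inv_letter a) w) = w.
Proof.
case: w => [|b w]; first by rewrite /= eqxx.
rewrite reduced_cons => /andP[hb _] /=; rewrite inv_letterK.
case: eqP => [eba|_]; last by rewrite /= eqxx.
case: w hb => [|c w]; rewrite /= eba //.
by move=> /negbTE ->.
Qed.

Lemma mul_cons_reduce a v w : reduced w ->
  mul_words (cons_reduce a v) w = cons_reduce a (mul_words v w).
Proof.
move=> rw; case: v => [|b v] //=; case: ifP => // /eqP ->.
by rewrite cons_reduceK // reduced_mul.
Qed.

Lemma mul_wordsA u v w : reduced w ->
  mul_words u (mul_words v w) = mul_words (mul_words u v) w.
Proof. by move=> rw; elim: u => //= a u ->; rewrite mul_cons_reduce. Qed.

Lemma mul_words1 w : reduced w -> mul_words w [::] = w.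
Proof.
elim: w => [//|a w IHw]; rewrite reduced_cons /= => /andP[haw /IHw ->].
by case: w haw {IHw} => [|b w] //= /negbTE ->.
Qed.

Lemma reduced_inv w : reduced w -> reduced (inv_word w).
Proof.
rewrite /reduced /inv_word rev_sorted sorted_map.
apply: sub_sorted => a b /=.
by rewrite inv_letterK eq_sym.
Qed.

Lemma mul_inv_word w : mul_words (inv_word w) w = [::].
Proof.
elim: w => [//|a w IHw]; rewrite /inv_word /= rev_cons -cats1.
rewrite /mul_words foldr_cat /= inv_letterK eqxx; exact: IHw.
Qed.

Lemma inv_wordK : involutive inv_word.
Proof.
move=> w; rewrite /inv_word map_rev revK -map_comp.
by rewrite (eq_map (g := id)) ?map_id // => a; exact: inv_letterK.
Qed.

Lemma mul_word_inv w : mul_words w (inv_word w) = [::].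
Proof. by rewrite -{1}(inv_wordK w) mul_inv_word. Qed.

Definition free_one := @FreeGroupElt [::] isT.
Definition free_mul (x y : free_group) :=
  FreeGroupElt (reduced_mul (word x) (valP y)).
Definition free_inv (x : free_group) := FreeGroupElt (reduced_inv (valP x)).

Lemma free_mulA : associative free_mul.
Proof. by move=> x y z; apply/val_inj/mul_wordsA/valP. Qed.

Lemma free_mul1 : left_id free_one free_mul.
Proof. by move=> x; apply/val_inj. Qed.

Lemma free_mulr1 : right_id free_one free_mul.
Proof. by move=> x; apply/val_inj/mul_words1/valP. Qed.

Lemma free_mulV : left_inverse free_one free_inv free_mul.
Proof. by move=> x; apply/val_inj/mul_inv_word. Qed.

Lemma free_mulrV : right_inverse free_one free_inv free_mul.
Proof. by move=> x; apply/val_inj/mul_word_inv. Qed.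

HB.instance Definition _ := isGroup.Build free_group
  free_mulA free_mul1 free_mulr1 free_mulV free_mulrV.

End FreeGroup.

Section Subgroups.
Variable G : groupType.

Definition is_subgroup (H : set G) :=
  H 1 /\ forall x y, H x -> H y -> H (x * y^-1).

Record normal_subgroup := NormalSubgroup {
  normal_set :> G -> Prop;
  normal_is_subgroup : is_subgroup normal_set;
  normal_conj : forall x y, normal_set x -> normal_set (x ^ y)
}.

Definition commutator_subgroup (A B : set G) : set G :=
  smallest is_subgroup [set [~ x, y] | x in A & y in B].

Definition derived_series (k : nat) : set G :=
  iter k (fun H => commutator_subgroup H H) setT.

Lemma smallest_is_subgroup (A : set G) : is_subgroup (smallest is_subgroup A).
Proof.
split=> [H [[]] //|x y hx hy H hH].
by case: (hH) => -[_ hD] _; apply: hD; [exact: hx|exact: hy].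
Qed.

Lemma derived_series_is_subgroup k : is_subgroup (derived_series k).
Proof. by case: k => [|k]; [split|exact: smallest_is_subgroup]. Qed.

Lemma derived_series_conj k x y :
  derived_series k x -> derived_series k (x ^ y).
Proof.
elim: k => [//|k IHk] in x y *; rewrite /derived_series /= => hx.
pose K := [set z | derived_series k.+1 (z ^ y)].
suff: K x by [].
apply: hx; split; first split.
- by rewrite /K /= conj1g; case: (derived_series_is_subgroup k.+1).
- move=> u v hu hv; rewrite /K /= conjMg conjVg.
  by case: (derived_series_is_subgroup k.+1) => _; apply.
- move=> _ [u hu [v hv <-]]; rewrite /K /= conjRg => H [_]; apply.
  by exists (u ^ y); [exact: IHk|exists (v ^ y); [exact: IHk|]].
Qed.

Definition derived_normal k : normal_subgroup :=
  NormalSubgroup (derived_series_is_subgroup k) (@derived_series_conj k).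

End Subgroups.
Arguments derived_series : clear implicits.
Arguments derived_normal : clear implicits.

Section QuotientGroup.
Variables (G : groupType) (N : normal_subgroup G).

Definition coset_rel (x y : G) : bool := `[< N (x^-1 * y) >].

Lemma normal1 : N 1.
Proof. by case: (normal_is_subgroup N). Qed.

Lemma normalV x : N x -> N x^-1.
Proof.
by case: (normal_is_subgroup N) => N1 ND /(ND _ _ N1); rewrite mul1g.
Qed.

Lemma normalM x y : N x -> N y -> N (x * y).
Proof.
move=> Nx /normalV Ny; case: (normal_is_subgroup N) => _ /(_ _ _ Nx Ny).
by rewrite invgK.
Qed.

Lemma coset_rel_refl : reflexive coset_rel.
Proof. by move=> x; apply/asboolP; rewrite mulVg; exact: normal1. Qed.

Lemma coset_rel_sym : symmetric coset_rel.
Proof.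
by move=> x y; apply/asboolP/asboolP => /normalV; rewrite invgM invgK.
Qed.

Lemma coset_rel_trans : transitive coset_rel.
Proof.
move=> y x z /asboolP hxy /asboolP hyz; apply/asboolP.
by have := normalM hxy hyz; rewrite mulgA -(mulgA _ y) mulgV mulg1.
Qed.

Canonical coset_equiv :=
  EquivRel coset_rel coset_rel_refl coset_rel_sym coset_rel_trans.

Local Open Scope quotient_scope.

Definition quotient_group := {eq_quot coset_equiv}.

HB.instance Definition _ := Choice.on quotient_group.
HB.instance Definition _ := EqQuotient.on quotient_group.

Definition quotient_one : quotient_group := \pi_quotient_group 1.
Definition quotient_mul (a b : quotient_group) : quotient_group :=
  \pi_quotient_group (repr a * repr b).
Definition quotient_inv (a : quotient_group) : quotient_group :=
  \pi_quotient_group (repr a)^-1.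

Lemma coset_eqP (x y : G) :
  reflect (\pi_quotient_group x = \pi_quotient_group y) `[< N (x^-1 * y) >].
Proof. exact: (iffP (eqmodP coset_equiv x y)). Qed.

Lemma repr_piP (x : G) : N (x^-1 * repr (\pi_quotient_group x)).
Proof. by apply/asboolP/coset_eqP; rewrite reprK. Qed.

Lemma quotient_mul_pi (x y : G) :
  quotient_mul (\pi_quotient_group x) (\pi_quotient_group y)
  = \pi_quotient_group (x * y).
Proof.
apply/esym/coset_eqP/asboolP.
set x' := repr (\pi_quotient_group x); set y' := repr (\pi_quotient_group y).
have -> : (x * y)^-1 * (x' * y') = (x^-1 * x') ^ y * (y^-1 * y').
  by rewrite invgM conjgE !mulgA mulgK.
by apply: normalM; [apply: normal_conj|]; exact: repr_piP.
Qed.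

Lemma quotient_inv_pi (x : G) :
  quotient_inv (\pi_quotient_group x) = \pi_quotient_group x^-1.
Proof.
apply/coset_eqP/asboolP; rewrite invgK.
have -> : repr (\pi_quotient_group x) * x^-1
          = (x^-1 * repr (\pi_quotient_group x)) ^ x^-1.
  by rewrite conjgE invgK !mulgA mulgV mul1g.
by apply: normal_conj; exact: repr_piP.
Qed.

Lemma quotient_mulA : associative quotient_mul.
Proof.
elim/quotW=> x; elim/quotW=> y; elim/quotW=> z.
rewrite (quotient_mul_pi y z) (quotient_mul_pi x y).
by rewrite (quotient_mul_pi x (y * z)) (quotient_mul_pi (x * y) z) mulgA.
Qed.

Lemma quotient_mul1 : left_id quotient_one quotient_mul.
Proof. by elim/quotW=> x; rewrite (quotient_mul_pi 1 x) mul1g. Qed.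

Lemma quotient_mulr1 : right_id quotient_one quotient_mul.
Proof. by elim/quotW=> x; rewrite (quotient_mul_pi x 1) mulg1. Qed.

Lemma quotient_mulV : left_inverse quotient_one quotient_inv quotient_mul.
Proof.
by elim/quotW=> x; rewrite quotient_inv_pi (quotient_mul_pi x^-1 x) mulVg.
Qed.

Lemma quotient_mulrV : right_inverse quotient_one quotient_inv quotient_mul.
Proof.
by elim/quotW=> x; rewrite quotient_inv_pi (quotient_mul_pi x x^-1) mulgV.
Qed.

HB.instance Definition _ := isGroup.Build quotient_group
  quotient_mulA quotient_mul1 quotient_mulr1 quotient_mulV quotient_mulrV.

End QuotientGroup.

Definition free_solvable_group (r k : nat) : groupType :=
  quotient_group (derived_normal (free_group 'I_r) k).

Section Reidemeister.
Variable G : groupType.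

Definition reidemeister_equiv (phi : {multiplicative G -> G}) (x y : G) :=
  exists z : G, x = z * y * (phi z)^-1.

Definition reidemeister_classes (phi : {multiplicative G -> G}) :
    set (set G) :=
  range (fun x => [set y | reidemeister_equiv phi x y]).

Definition reidemeister_number (phi : {multiplicative G -> G}) : \bar nat :=
  if `[< finite_set (reidemeister_classes phi) >]
  then (#|` fset_set (reidemeister_classes phi)|)%fset%:E%E else +oo%E.

End Reidemeister.

Definition R_infty (G : groupType) :=
  forall phi : {multiplicative G -> G},
    bijective phi -> reidemeister_number phi = +oo%E.

(* Main.v *)
From HB Require Import structures.
Require Import Defs.
From mathcomp Require Import all_boot all_order all_algebra all_field.
From mathcomp Require Import spectral.
From mathcomp Require Import finmap.
From mathcomp Require Import boolp classical_sets functions cardinality.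
From mathcomp Require Import constructive_ereal.

(** Exponent sums identify the quotient of the free group F by its commutator
    subgroup F' with the lattice Z^r.  On an abelian group, x and y are
    equivalent under inversion when they differ by a square, and the squares
    have index 2 ^ r in Z^r; so inversion has finitely many classes.

    Let now k >= 2, let phi be an automorphism of F / F^(k), lifted to an
    endomorphism of F, and let A be the integral matrix by which it acts on
    Z^r; its determinant is 1 or -1.  Infinitely many classes are produced by
    additive invariants: if f is an additive map, with values in a vector space
    of characteristic 0, that satisfies f (phi g) = f g, then the powers of an
    element m with f m != 0 are pairwise inequivalent
    (reidemeister_infinite_of_invariant).  If det (A - 1) = 0, a fixed linear
    form on Z^r is such an invariant.  Otherwise A has no nonzero fixed vector,
    hence two elements of F' can only be equivalent through some z in F', and it
    is enough to find a nonzero invariant f on F' (commutator_invariant); being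
    additive on F', it vanishes on F'' and thus on F^(k).

    Such an f is built from the Magnus cocycle, a crossed homomorphism of F
    with values in r-tuples of tensors, on which F acts through its exponent
    sums by translations.  This cocycle is additive on F' because F' acts
    trivially, and phi acts on its values by a linear map C
    (pullback_magnus).  After truncation at degree n = 2 r - 1 the values at F'
    span a finite dimensional space W, and the projection of W along the image
    of 1 - C gives an invariant, which is nonzero as soon as 1 - C does not map
    W onto itself.  On leading coefficients C is the (n + 1)-st tensor power of
    A (pullback_lead).  After putting A over the algebraic numbers in triangular
    form by Schur's theorem, a combination of iterated commutators has leading
    coefficients supported on the words in which each of the r indices occurs
    exactly twice (kernel_span_leading).  Up to words of smaller weight it is an
    eigenvector of C for the eigenvalue det A ^ 2 = 1.  Being fixed modulo a
    C-stable subspace that does not contain it, it prevents 1 - C from being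
    onto (fixed_mod_not_onto).  The iterated commutators start with a commutator
    of two distinct generators, which is where r > 1 is used. *)

Set Implicit Arguments.
Unset Strict Implicit.
Unset Printing Implicit Defensive.

Import Order.TTheory GRing.Theory Num.Theory.

(** * Free groups and crossed homomorphisms *)

Section FreeUniversal.
Local Open Scope group_scope.
Variable X : choiceType.
Notation F := (free_group X).

Definition gen (x : X) : F := @FreeGroupElt X [:: (x, true)] isT.

Lemma free_group_ind (P : F -> Prop) :
  P 1 -> (forall x g, P g -> P (gen x * g)) ->
  (forall x g, P g -> P ((gen x)^-1 * g)) -> forall g, P g.
Proof.
move=> P1 Pg PV [w]; elim: w => [|a w IHw] rw.
  by rewrite (_ : FreeGroupElt rw = 1) //; exact: val_inj.
have rw' : reduced w by move: rw; rewrite reduced_cons => /andP[].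
case: a rw => x b rw.
have aw : cons_reduce (x, b) w = (x, b) :: w.
  by case: w rw {IHw rw'} => //= c w /andP[/negbTE ->].
case: b rw aw => rw aw.
  rewrite (_ : FreeGroupElt rw = gen x * FreeGroupElt rw'); first exact/Pg/IHw.
  exact/val_inj/esym.
rewrite (_ : FreeGroupElt rw = (gen x)^-1 * FreeGroupElt rw').
  exact/PV/IHw.
exact/val_inj/esym.
Qed.

Section Action.
Variables (T : Type) (act : X * bool -> T -> T).
Hypothesis actK : forall a t, act a (act (inv_letter a) t) = t.

(** Reduction cancels a letter against its inverse, which does not change the
    resulting bijection. Homomorphisms to a group and crossed homomorphisms are
    both instances, for suitable sets T. *)
Lemma foldr_act_mul (g h : F) t :
  foldr act t (word (g * h)) = foldr act (foldr act t (word h)) (word g).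
Proof.
rewrite [word (g * h)]/(mul_words (word g) (word h)).
elim: (word g) => //= a w <-; move: (foldr _ _ w) => [|b v] //=.
by case: eqP => // ->; rewrite actK.
Qed.

End Action.

(** The letter x acts on H as the left multiplication by h x. *)
Lemma free_lift (H : groupType) (h : X -> H) :
  exists phi : F -> H,
    (forall x, phi (gen x) = h x) /\ {morph phi : x y / x * y}.
Proof.
pose act (a : X * bool) (t : H) := (if a.2 then h a.1 else (h a.1)^-1) * t.
have actK a t : act a (act (inv_letter a) t) = t.
  by case: a => x [] /=; rewrite /act /= ?mulVKg ?mulKg.
exists (fun g => foldr act 1 (word g)); split=> [x|g k].
  by rewrite /= /act mulg1.
rewrite (foldr_act_mul actK); elim: (word g) => [|a w /= ->].
  by rewrite /= mul1g.
by rewrite /act mulgA.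
Qed.

(** The letter x acts on E by the affine map e |-> c x + rho x e; the value of
    the crossed homomorphism at g is the image of 0 under g. *)
Lemma crossed_hom_exists (E : zmodType) (rho : F -> {additive E -> E})
    (c : X -> E) :
  (forall g h e, rho (g * h) e = rho g (rho h e)) -> (forall e, rho 1 e = e) ->
  exists D : F -> E, (forall x, D (gen x) = c x) /\
    forall g h, D (g * h) = (D g + rho g (D h))%R.
Proof.
move=> rhoM rho1.
pose act (a : X * bool) (e : E) : E :=
  (if a.2 then c a.1 + rho (gen a.1) e else rho (gen a.1)^-1%g (e - c a.1))%R.
have actK a t : act a (act (inv_letter a) t) = t.
  case: a => x [] /=; rewrite /act /=.
    by rewrite -rhoM mulgV rho1 addrC subrK.
  by rewrite addrC addKr -rhoM mulVg rho1.
have actD g e : foldr act e (word g) = (foldr act 0 (word g) + rho g e)%R.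
  move: g; apply: free_group_ind => [|x g IH|x g IH].
  - by rewrite /= rho1 add0r.
  - by rewrite !(foldr_act_mul actK) /= IH /act /= raddfD /= addrA rhoM.
  rewrite !(foldr_act_mul actK) /= IH /act /= rhoM -raddfD /=.
  by rewrite addrAC.
exists (fun g => foldr act 0%R (word g)); split=> [x|g h].
  by rewrite /= /act /= raddf0 addr0.
by rewrite (foldr_act_mul actK) actD.
Qed.

Section CrossedHom.
Variables (E : zmodType) (rho : F -> {additive E -> E}) (D : F -> E).
Hypothesis rho1 : forall e, rho 1 e = e.
Hypothesis DM : forall g h, D (g * h) = (D g + rho g (D h))%R.

Lemma crossed_hom1 : D 1 = 0%R.
Proof.
have := DM 1 1; rewrite mulg1 rho1 => /eqP.
by rewrite -subr_eq subrr eq_sym => /eqP.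
Qed.

Lemma crossed_homV g : D g^-1 = (- rho g^-1%g (D g))%R.
Proof.
by apply/eqP; rewrite -addr_eq0 -DM mulVg crossed_hom1.
Qed.

End CrossedHom.

Lemma crossed_hom_unique (E : zmodType) (rho : F -> {additive E -> E})
    (D D' : F -> E) :
  (forall g h e, rho (g * h) e = rho g (rho h e)) -> (forall e, rho 1 e = e) ->
  (forall g h, D (g * h) = (D g + rho g (D h))%R) ->
  (forall g h, D' (g * h) = (D' g + rho g (D' h))%R) ->
  (forall x, D (gen x) = D' (gen x)) -> forall g, D g = D' g.
Proof.
move=> rhoM rho1 DM DM' e; apply: free_group_ind => [|x g IH|x g IH].
- by rewrite (crossed_hom1 rho1 DM) (crossed_hom1 rho1 DM').
- by rewrite DM DM' IH e.
by rewrite DM DM' IH (crossed_homV rho1 DM) (crossed_homV rho1 DM') e.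
Qed.

End FreeUniversal.

(** * Derived series and quotients *)

Section DerivedSeries.
Local Open Scope group_scope.
Local Open Scope classical_set_scope.
Variable G : groupType.
Implicit Types H : set G.

Lemma subgroupV H x : is_subgroup H -> H x -> H x^-1.
Proof. by case=> H1 HD Hx; rewrite -(mul1g x^-1); exact: HD. Qed.

Lemma subgroupM H x y : is_subgroup H -> H x -> H y -> H (x * y).
Proof. by move=> Hs Hx /(subgroupV Hs) Hy; rewrite -(invgK y); apply Hs.2. Qed.

Lemma derived_series_comm k x y : derived_series G k x ->
  derived_series G k y -> derived_series G k.+1 [~ x, y].
Proof. by move=> hx hy K [_]; apply; exists x => //; exists y. Qed.

Lemma derived_series_anti j k : (j <= k)%N ->
  derived_series G k `<=` derived_series G j.
Proof.
move=> /subnK <-; elim: (k - j)%N => // n IHn; rewrite addSn => x hx; apply: IHn.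
apply: (hx); split; first exact: derived_series_is_subgroup.
move=> _ [u hu [v hv <-]]; rewrite commgEl.
have hN := @derived_series_is_subgroup G (n + j).
by apply: subgroupM => //; [exact: subgroupV|exact: derived_series_conj].
Qed.

(** A map that is only defined additively on one term of the series still kills
    the commutators of that term. *)
Lemma additive_on_derived_eq0 (E : zmodType) (P : G -> E) k :
  (forall x y, derived_series G k x -> derived_series G k y ->
    P (x * y) = (P x + P y)%R) ->
  forall x, derived_series G k.+1 x -> P x = 0%R.
Proof.
move=> PM; have Dk := @derived_series_is_subgroup G k.
have P1 : P 1 = 0%R.
  have := PM 1 1 Dk.1 Dk.1; rewrite mulg1 => /eqP.
  by rewrite -subr_eq subrr eq_sym => /eqP.
have PV x : derived_series G k x -> P x^-1 = (- P x)%R.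
  move=> hx; apply/eqP; rewrite -addr_eq0 -PM //; last exact: subgroupV.
  by rewrite mulVg P1.
suff: derived_series G k.+1 `<=` derived_series G k `&` [set x | P x = 0%R].
  by move=> s x /s[].
move=> x; apply; split.
  split=> [|u v [hu Pu] [hv Pv]]; first by split; [exact: Dk.1|].
  by split; [exact: Dk.2|rewrite /= PM ?PV ?Pu ?Pv ?oppr0 ?addr0 //;
    exact: subgroupV].
move=> _ [u hu [v hv <-]].
have hV := subgroupV Dk; have hM := @subgroupM _ _ _ Dk.
split; first by rewrite commgEl; apply: hM; [exact: hV|exact: derived_series_conj].
have [hu' hv'] := (hV _ hu, hV _ hv); have huv := hM _ _ hu hv.
rewrite /= /commg conjgE (PM _ _ hu' (hM _ _ hv' huv)) (PM _ _ hv' huv) PM //.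
by rewrite !PV // (addrC (P u)) addKr addNr.
Qed.

End DerivedSeries.

Section Quotient.
Local Open Scope group_scope.
Local Open Scope quotient_scope.
Variables (G : groupType) (N : normal_subgroup G).

Lemma pi_mul (x y : G) : \pi_(quotient_group N) (x * y)
  = \pi_(quotient_group N) x * \pi_(quotient_group N) y.
Proof. exact/esym/quotient_mul_pi. Qed.

Lemma pi_inv (x : G) :
  \pi_(quotient_group N) x^-1 = (\pi_(quotient_group N) x)^-1.
Proof. exact/esym/quotient_inv_pi. Qed.

Lemma pi_eqP (x y : G) :
  \pi_(quotient_group N) x = \pi_(quotient_group N) y <-> N (x^-1 * y).
Proof. by split=> [/coset_eqP/asboolP|h]; [|apply/coset_eqP/asboolP]. Qed.

End Quotient.

(** * The abelianization *)

Section Abelianization.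
Local Open Scope group_scope.
Variable r : nat.
Notation F := (free_group 'I_r).

(** The exponent sums, as the crossed homomorphism for the trivial action that
    sends the generators to the standard basis. *)
Definition ab : F -> 'rV[int]_r :=
  sval (cid (@crossed_hom_exists _ _ (fun=> idfun)
    (fun i => delta_mx ord0 i) (fun _ _ _ => erefl) (fun _ => erefl))).

Lemma ab_gen i : ab (gen i) = delta_mx ord0 i.
Proof. by rewrite /ab; case: cid => D /= []. Qed.

Lemma abM g h : ab (g * h) = (ab g + ab h)%R.
Proof. by rewrite /ab; case: cid => D /= []. Qed.

Lemma ab1 : ab 1 = 0%R.
Proof. exact: (@crossed_hom1 _ _ (fun=> idfun) ab _ abM). Qed.

Lemma abV g : ab g^-1 = (- ab g)%R.
Proof. exact: (@crossed_homV _ _ (fun=> idfun) ab _ abM). Qed.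

Lemma ab_derived g : derived_series F 1 g -> ab g = 0%R.
Proof. by apply: additive_on_derived_eq0 => x y _ _; exact: abM. Qed.

(** A copy of the abelianization written additively, so that integral linear
    combinations of its elements are available. *)
Definition ab_quotient : Type := free_solvable_group r 1.
HB.instance Definition _ := Choice.on ab_quotient.

Fact ab_quotient_mulC :
  commutative (fun x y : free_solvable_group r 1 => x * y).
Proof.
elim/quotW=> x; elim/quotW=> y; rewrite -!pi_mul; apply/pi_eqP.
rewrite (_ : _ * _ = [~ y, x]); first exact: derived_series_comm.
by rewrite commgEl conjgE invgM !mulgA.
Qed.

HB.instance Definition _ := @GRing.isZmodule.Build ab_quotient
  _ _ _ (@mulgA (free_solvable_group r 1)) ab_quotient_mulC
  (@mul1g (free_solvable_group r 1)) (@mulVg (free_solvable_group r 1)).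

End Abelianization.

Section AbelianizationIso.
Local Open Scope group_scope.
Local Open Scope quotient_scope.
Variable r : nat.
Notation F := (free_group 'I_r).
Notation Q := (free_solvable_group r 1).
Notation pi1 := (\pi_(quotient_group (derived_normal F 1))).

Definition ab_bar (q : Q) : 'rV[int]_r := ab (repr q).

Lemma ab_bar_pi g : ab_bar (pi1 g) = ab g.
Proof.
apply/eqP; rewrite -subr_eq0 addrC -abV -abM; apply/eqP.
exact: ab_derived (repr_piP (derived_normal F 1) g).
Qed.

Lemma ab_barM x y : ab_bar (x * y) = (ab_bar x + ab_bar y)%R.
Proof.
by elim/quotW: x => x; elim/quotW: y => y; rewrite -pi_mul !ab_bar_pi abM.
Qed.

(** The inverse of ab_bar. *)
Definition ab_section (v : 'rV[int]_r) : ab_quotient r :=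
  (\sum_i (pi1 (gen i) : ab_quotient r) *~ v ord0 i)%R.

Lemma ab_sectionD : {morph ab_section : u v / (u + v)%R}.
Proof.
move=> u v; rewrite /ab_section -big_split /=.
by apply: eq_bigr => i _; rewrite mxE mulrzDr.
Qed.

Lemma ab_section_delta i : ab_section (delta_mx ord0 i) = pi1 (gen i).
Proof.
rewrite /ab_section (bigD1 i) //= mxE !eqxx mulr1z big1 ?addr0 // => j ji.
by rewrite mxE (negbTE ji) andbF mulr0z.
Qed.

Lemma ab_section0 : ab_section 0%R = 0%R.
Proof. by rewrite /ab_section big1 // => i _; rewrite mxE mulr0z. Qed.

Lemma ab_sectionN v : ab_section (- v)%R = (- ab_section v)%R.
Proof.
by apply/eqP; rewrite -addr_eq0 -ab_sectionD addNr ab_section0.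
Qed.

Lemma ab_section_ab g : ab_section (ab g) = pi1 g.
Proof.
move: g; apply: free_group_ind => [|i g IH|i g IH].
- by rewrite ab1 ab_section0.
- by rewrite abM ab_sectionD ab_gen ab_section_delta IH pi_mul.
by rewrite abM abV ab_sectionD ab_sectionN ab_gen ab_section_delta IH pi_mul
  pi_inv.
Qed.

Lemma ab_barK : cancel ab_bar ab_section.
Proof. by elim/quotW => g; rewrite ab_bar_pi ab_section_ab. Qed.

Lemma ab_sectionK : cancel ab_section ab_bar.
Proof.
have bar0 : ab_bar (0%R : ab_quotient r) = 0%R.
  by rewrite -ab_section0 -ab1 ab_section_ab ab_bar_pi.
have barN (x : ab_quotient r) : ab_bar (- x)%R = (- ab_bar x)%R.
  apply/eqP; rewrite -addr_eq0; apply/eqP.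
  by have := ab_barM (- x)%R x; rewrite mulVg => <-; exact: bar0.
have barn (x : ab_quotient r) n : ab_bar (x *+ n)%R = (ab_bar x *+ n)%R.
  by elim: n => [|n IHn]; [exact: bar0|rewrite !mulrS -IHn -ab_barM].
have barz (x : ab_quotient r) n : ab_bar (x *~ n)%R = (ab_bar x *~ n)%R.
  by case: n => n; [exact: barn|rewrite !NegzE !mulrNz barN barn].
move=> v; rewrite [RHS]row_sum_delta /ab_section.
rewrite (big_morph (ab_bar : ab_quotient r -> _) ab_barM bar0).
apply: eq_bigr => i _; rewrite barz ab_bar_pi ab_gen.
by rewrite -scaler_int intz.
Qed.

Lemma ab_bar_bij : bijective ab_bar.
Proof. by exists ab_section; [exact: ab_barK|exact: ab_sectionK]. Qed.

End AbelianizationIso.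

(** * Reidemeister classes *)

Section Reidemeister.
Local Open Scope group_scope.
Local Open Scope classical_set_scope.
Variables (G : groupType) (phi : {multiplicative G -> G}).

Lemma multiplicative1 : phi 1 = 1.
Proof. by apply: (mulgI (phi 1)); rewrite -gmulfM !mulg1. Qed.

Lemma multiplicativeV x : phi x^-1 = (phi x)^-1.
Proof.
by apply: (mulgI (phi x)); rewrite -gmulfM !mulgV multiplicative1.
Qed.

Lemma reidemeister_equivC x y :
  reidemeister_equiv phi x y -> reidemeister_equiv phi y x.
Proof.
by case=> z ->; exists z^-1; rewrite multiplicativeV invgK -!mulgA mulKg mulVg mulg1.
Qed.

Lemma reidemeister_equiv_trans x y t : reidemeister_equiv phi x y ->
  reidemeister_equiv phi y t -> reidemeister_equiv phi x t.
Proof.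
by case=> z -> [w ->]; exists (z * w); rewrite gmulfM invgM !mulgA.
Qed.

Lemma reidemeister_number_infinite (x : nat -> G) :
  (forall i j, reidemeister_equiv phi (x i) (x j) -> i = j) ->
  reidemeister_number phi = +oo%E.
Proof.
move=> xinj; rewrite /reidemeister_number; case: asboolP => // fin.
have [] := infinite_nat; pose c i := [set y | reidemeister_equiv phi (x i) y].
rewrite (_ : setT = c @^-1` reidemeister_classes phi); last first.
  by apply/esym/seteqP; split=> // i _; exists (x i).
apply: finite_preimage => // i j _ _ cij; apply: xinj.
rewrite -[reidemeister_equiv _ _ _]/(c i (x j)) cij.
by exists 1; rewrite multiplicative1 invg1 mulg1 mul1g.
Qed.

End Reidemeister.

Section InverseOnAbelian.
Local Open Scope group_scope.
Local Open Scope classical_set_scope.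
Variable r : nat.
Notation G := (free_solvable_group r 1).

Definition ab_inv (x : G) : G := x^-1.

Fact ab_inv_mul : {morph ab_inv : x y / x * y}.
Proof. by move=> x y; rewrite /ab_inv invgM; exact: ab_quotient_mulC. Qed.

HB.instance Definition _ := isMultiplicative.Build G G ab_inv ab_inv_mul.

(** Modulo squares, every class contains an element whose exponent sums are
    all 0 or 1. *)
Lemma ab_inv_finite_classes :
  finite_set (reidemeister_classes (ab_inv : {multiplicative G -> G})).
Proof.
pose row_of (p : {ffun 'I_r -> 'I_2}) : 'rV[int]_r := (\row_i (p i : nat)%:Z)%R.
pose cl (p : {ffun 'I_r -> 'I_2}) : set G :=
  [set y | reidemeister_equiv (ab_inv : {multiplicative G -> G})
             (ab_section (row_of p)) y].
apply: (@sub_finite_set _ _ (range cl)); last exact/finite_image/finite_finset.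
move=> _ [x _ <-]; pose v := ab_bar x.
pose p := [ffun i => inord `|(v ord0 i %% 2)%Z|%N : 'I_2]; exists p => //.
have xp : reidemeister_equiv (ab_inv : {multiplicative G -> G})
    (ab_section (row_of p)) x.
  apply: reidemeister_equivC; exists (ab_section (\row_i (v ord0 i %/ 2)%Z)%R).
  apply: (bij_inj (@ab_bar_bij r)); rewrite invgK !ab_barM !ab_sectionK.
  apply/rowP => i; rewrite !mxE ffunE inordK; last first.
    by rewrite -ltz_nat gez0_abs ?modz_ge0 // ltz_pmod.
  rewrite gez0_abs ?modz_ge0 // [LHS](divz_eq _ 2) addrAC.
  by rewrite mulrDr mulr1.
apply/seteqP; split=> y /=; apply: reidemeister_equiv_trans => //.
exact: reidemeister_equivC.
Qed.

Lemma abelianization_not_R_infty : ~ R_infty G.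
Proof.
move=> /(_ (ab_inv : {multiplicative G -> G})) H.
have /H : bijective ab_inv by exists ab_inv => x; rewrite /ab_inv invgK.
by rewrite /reidemeister_number; case: asboolP => // [[]]; exact: ab_inv_finite_classes.
Qed.

End InverseOnAbelian.

(** * Linear algebra *)

Section LinearAlgebra.
Local Open Scope ring_scope.
Variables (K : fieldType) (E : vectType K).
Implicit Types (C : 'End(E)) (W S : {vspace E}).

(** A vector that is fixed only modulo an invariant subspace already prevents
    1 - C from being onto: otherwise 1 - C would be bijective on W and on
    W :&: S, and v would lie in S. *)
Lemma fixed_mod_not_onto C W S v :
  (C @: W <= W)%VS -> (C @: S <= S)%VS -> v \in W -> v \notin S ->
  v - C v \in S -> ~~ (W <= (\1%VF - C) @: W)%VS.
Proof.
move=> CW CS vW vS CvS; apply/negP => onto; set D := (\1%VF - C)%R in onto.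
have DE x : D x = x - C x by rewrite add_lfunE opp_lfunE id_lfunE.
have ker0 : (W :&: lker D = 0)%VS.
  apply/eqP; rewrite -dimv_eq0 -leqn0 -(leq_add2r (\dim (D @: W))).
  by rewrite limg_ker_dim add0n dimvS.
have stab U : (C @: U <= U)%VS -> (D @: U <= U)%VS.
  move=> CU; apply/subvP => _ /memv_imgP[x xU ->]; rewrite DE rpredB //.
  by apply: (subvP CU); exact: memv_img.
have CU : (C @: (W :&: S) <= W :&: S)%VS.
  by rewrite subv_cap (subv_trans (limgS _ (capvSl _ _)) CW)
    (subv_trans (limgS _ (capvSr _ _)) CS).
have : (D @: (W :&: S) == W :&: S)%VS.
  rewrite eqEdim stab //= -(limg_ker_dim D (W :&: S)).
  rewrite (_ : (W :&: S :&: lker D = 0)%VS) ?dimv0 ?add0n //.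
  by apply/eqP; rewrite eqEsubv sub0v andbT -ker0 capvS // capvSl.
have DvU : D v \in (W :&: S)%VS.
  by rewrite memv_cap DE CvS andbT rpredB // (subvP CW) // memv_img.
move=> /eqP U; move: DvU; rewrite -{}U => /memv_imgP[u].
rewrite memv_cap => /andP[uW uS] Dvu.
have : v - u \in (W :&: lker D)%VS.
  by rewrite memv_cap rpredB // memv_ker linearB /= Dvu subrr.
by rewrite ker0 memv0 subr_eq0 => /eqP vu; rewrite vu uS in vS.
Qed.

(** The smallest subspace containing an arbitrary family; it exists because
    an increasing chain of spans has bounded dimension. *)
Lemma span_of_family (I : Type) (A : I -> Prop) (f : I -> E) :
  exists W, (forall i, A i -> f i \in W) /\
    forall S, (forall i, A i -> f i \in S) -> (W <= S)%VS.
Proof.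
pose good W := forall S, (forall i, A i -> f i \in S) -> (W <= S)%VS.
suff H n W : good W -> (\dim {:E} <= n + \dim W)%N ->
    exists W, (forall i, A i -> f i \in W) /\ good W.
  by apply: (H (\dim {:E}) 0%VS); [move=> S _; exact: sub0v|rewrite leq_addr].
elim: n => [|n IHn] in W *; move=> gW leW.
  exists W; split=> // i _; rewrite (_ : W = fullv) ?memvf //.
  by apply/eqP; rewrite eqEdim subvf.
have [//|/existsNP[i /not_implyP[Ai /negP fi]]] :=
  pselect (forall i, A i -> f i \in W).
  by exists W.
apply: (IHn (W + <[f i]>)%VS).
  by move=> S AS; rewrite subv_add gW //= -memvE AS.
apply: leq_trans leW _; rewrite addSnnS leq_add2l.
rewrite ltn_neqAle dimvS ?addvSl // andbT.
apply: contra fi => /eqP eqd.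
have /eqP -> : W == (W + <[f i]>)%VS by rewrite eqEdim addvSl -eqd leqnn.
by rewrite memvE addvSr.
Qed.

End LinearAlgebra.

(** * Translations and linear substitutions on tensors *)

Section Tensors.
Local Open Scope ring_scope.
Variables (K : fieldType) (r : nat).
Notation tensor := (seq 'I_r -> K^o).
Implicit Types (tau : tensor) (s : seq 'I_r) (u : 'rV[K]_r) (M : 'M[K]_r).

Definition shift i tau : tensor := fun s => tau (i :: s).

(** A tensor is a linear functional on the noncommutative polynomials in r
    variables, given by its values at the words. The translation by u replaces
    each variable y_i by y_i + u_i. *)
Fixpoint translate u tau s : K^o :=
  if s is i :: s' then translate u (shift i tau) s' + u ord0 i * translate u tau s'
  else tau [::].

(** Replaces each variable y_i by the i-th coordinate of v *m M, where v is the
    row of all variables; in each degree, this is a tensor power of M. *)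
Fixpoint substitute M tau s : K^o :=
  if s is i :: s' then \sum_k M k i * substitute M (shift k tau) s' else tau [::].

(** The part of the translation by u that is linear in u. *)
Fixpoint derivation u tau s : K^o :=
  if s is i :: s' then derivation u (shift i tau) s' + u ord0 i * tau s' else 0.

Definition unit_tensor : tensor := fun s => (s == [::])%:R.

Definition low n tau := forall s, (size s < n)%N -> tau s = 0.

(** Reduces the module structure of K over itself to the product of K. *)
Lemma regE (a : K) (x : K^o) : a *: x = a * x :> K.
Proof. by []. Qed.

Lemma shift_linear i : linear (shift i).
Proof. by []. Qed.
HB.instance Definition _ i :=
  GRing.isLinear.Build K tensor tensor _ (shift i) (@shift_linear i).

Lemma translate_linear u : linear (translate u).
Proof.
move=> a tau tau'; apply/funext => s; elim: s tau tau' => [|i s IHs] tau tau' //=.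
rewrite linearP !IHs /= !fctE /=.
by rewrite !regE !mulrDr addrACA !(mulrCA a).
Qed.
HB.instance Definition _ u :=
  GRing.isLinear.Build K tensor tensor _ (translate u) (@translate_linear u).

Lemma substitute_linear M : linear (substitute M).
Proof.
move=> a tau tau'; apply/funext => s; elim: s tau tau' => [|i s IHs] tau tau' //=.
rewrite !fctE /= regE mulr_sumr -big_split /=; apply: eq_bigr => k _.
by rewrite linearP IHs !fctE regE mulrDr mulrCA.
Qed.
HB.instance Definition _ M :=
  GRing.isLinear.Build K tensor tensor _ (substitute M) (@substitute_linear M).

Lemma derivation_linear u : linear (derivation u).
Proof.
move=> a tau tau'; apply/funext => s; elim: s tau tau' => [|i s IHs] tau tau' /=.
  by rewrite !fctE scaler0 addr0.
rewrite linearP !IHs /= !fctE /=.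
by rewrite !regE !mulrDr addrACA !(mulrCA a).
Qed.
HB.instance Definition _ u :=
  GRing.isLinear.Build K tensor tensor _ (derivation u) (@derivation_linear u).

Lemma derivation_suml (I : finType) (a : I -> K) (u : I -> 'rV[K]_r) tau s :
  derivation (\sum_i a i *: u i) tau s = \sum_i a i * derivation (u i) tau s.
Proof.
elim: s tau => [|j s IHs] tau /=; first by rewrite big1 // => i _; rewrite mulr0.
rewrite IHs summxE mulr_suml -big_split /=; apply: eq_bigr => i _.
by rewrite mxE mulrDr mulrA.
Qed.

Lemma shift_translate i u tau :
  shift i (translate u tau) = translate u (shift i tau) + u ord0 i *: translate u tau.
Proof. by apply/funext. Qed.

Lemma shift_substitute i M tau :
  shift i (substitute M tau) = \sum_k M k i *: substitute M (shift k tau).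
Proof. by apply/funext => s; rewrite fct_sumE. Qed.

Lemma translate0 tau : translate 0 tau = tau.
Proof.
by apply/funext => s; elim: s tau => //= i s IHs tau; rewrite !IHs mxE mul0r addr0.
Qed.

Lemma translateD u v tau : translate (u + v) tau = translate u (translate v tau).
Proof.
apply/funext => s; elim: s tau => //= i s IHs tau.
rewrite shift_translate linearD linearZ /= !fctE -!IHs mxE mulrDl.
by rewrite [_ + u _ _ * _]addrC !addrA (addrC (u _ _ * _)).
Qed.

(** The tensor powers of M normalize the translations, as M does in the affine
    group. *)
Lemma substitute_translate M u tau :
  substitute M (translate u tau) = translate (u *m M) (substitute M tau).
Proof.
apply/funext => s; elim: s tau => //= i s IHs tau.
rewrite shift_substitute linear_sum fct_sumE /= mxE mulr_suml -big_split /=.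
apply: eq_bigr => k _; rewrite shift_translate linearD 2!linearZ /= !fctE !IHs.
by rewrite mulrDr mulrA [u _ _ * _]mulrC.
Qed.

Lemma low_shift n tau i : low n tau -> low n.-1 (shift i tau).
Proof. by move=> lt s ls; apply: lt => /=; case: n ls. Qed.

(** Expanding the product of the y_i + u_i over a word, all terms except the
    first belong to shorter words, where tau vanishes. *)
Lemma translate_lead n u tau s : low n tau -> (size s <= n)%N ->
  translate u tau s = tau s.
Proof.
elim: s n tau => //= i s IHs n tau lt ls.
rewrite (IHs n tau lt (ltnW ls)) (lt s ls) mulr0 addr0.
by apply: (IHs n.-1); [exact: low_shift|case: n ls {lt}].
Qed.

(** One degree above its lowest one, a tensor changes under a translation by an
    expression linear in the translation vector. Hence linear combinations of
    translations by vectors of a lattice reach all directions there. *)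
Lemma translate_diff n u tau s : low n tau -> (size s <= n.+1)%N ->
  translate u tau s - tau s = derivation u tau s.
Proof.
elim: s n tau => [|i s IHs] n tau lt ls /=; first by rewrite subrr.
rewrite (translate_lead u lt) // addrAC (IHs n.-1) //; first exact: low_shift lt.
exact: (@leq_trans n _ _ ls (leqSpred n)).
Qed.

Lemma derivation_low n u tau s : low n tau -> (size s <= n)%N ->
  derivation u tau s = 0.
Proof.
move=> lt ls; rewrite -(translate_diff u lt) ?(leqW ls) //.
by rewrite (translate_lead u lt ls) subrr.
Qed.

Lemma eq_derivation u tau tau' s :
  (forall s', size s = (size s').+1 -> tau s' = tau' s') ->
  derivation u tau s = derivation u tau' s.
Proof.
elim: s tau tau' => //= i s IHs tau tau' e; rewrite (e s) //; congr (_ + _).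
by apply: IHs => s' ss; apply: e; rewrite ss.
Qed.

Lemma low_substitute n M tau : low n tau -> low n (substitute M tau).
Proof.
move=> lt s; elim: s n tau lt => [|i s IHs] n tau lt ls /=; first exact: lt.
rewrite big1 // => k _; rewrite (IHs n.-1) ?mulr0 //; first exact: low_shift.
by case: n ls {lt}.
Qed.

Lemma substitute_unit M : substitute M unit_tensor = unit_tensor.
Proof.
apply/funext => -[|i s] //=; rewrite big1 // => k _.
rewrite (_ : shift k unit_tensor = 0) ?linear0 ?mulr0 //; exact/funext.
Qed.

(** Since M is lower triangular, the value at s only involves the words that
    are pointwise at least s; all of them except s have a larger sum. *)
Lemma substitute_trig M tau s : is_trig_mx M ->
  (forall s', size s' = size s -> (\sum_(i <- s) i < \sum_(i <- s') i)%N ->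
     tau s' = 0) ->
  substitute M tau s = \prod_(i <- s) M i i * tau s.
Proof.
move=> /is_trig_mxP Mtrig; elim: s tau => [|i s IHs] tau h /=.
  by rewrite big_nil mul1r.
rewrite big_cons (bigD1 i) //= IHs; last first.
  by move=> s' ss ls; apply: h; rewrite /= ?ss // !big_cons ltn_add2l.
rewrite mulrA [X in _ + X]big1 ?addr0 // => k ki; have [lt_ki|le_ik] := ltnP k i.
  by rewrite Mtrig ?mul0r.
have {ki le_ik} lt_ik : (i < k)%N by rewrite ltn_neqAle eq_sym ki.
have h' s' : size s' = size s -> (\sum_(i <- s) i <= \sum_(i <- s') i)%N ->
    tau (k :: s') = 0.
  move=> ss ls; apply: h; rewrite /= ?ss // !big_cons -addSn.
  exact: leq_add.
by rewrite IHs ?[shift _ _ _]h' ?mulr0 // => s' ss /ltnW ls; exact: h'.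
Qed.

End Tensors.

(** * Iterated derivations of the unit tensor *)

Section Matchings.
Variable r : nat.
Implicit Types (c : seq 'I_r -> nat) (s l : seq 'I_r).

(** The derivation in the k-th basis direction, on natural coefficients. *)
Fixpoint occurrences (k : 'I_r) c s : nat :=
  if s is i :: s' then occurrences k (fun s' => c (i :: s')) s' + (k == i) * c s'
  else 0.

(** The number of bijections between the positions of l and s that respect the
    letters, obtained as the derivation of the unit tensor along the directions
    listed in l. Being a count, it cannot vanish at l itself. *)
Fixpoint matchings l s : nat :=
  if l is k :: l' then occurrences k (matchings l') s else s == [::].

Lemma derivation_delta (K : fieldType) k c s :
  derivation (delta_mx ord0 k) (fun s => (c s)%:R : K^o)%R s
  = (occurrences k c s)%:R%R :> K.
Proof.
elim: s c => [//|i s IHs] c /=.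
by rewrite (IHs (fun s => c (i :: s))) !mxE eqxx /= -natrM -natrD eq_sym.
Qed.

Lemma occurrences_perm k c s : occurrences k c s != 0 ->
  exists2 s', c s' != 0 & perm_eq s (k :: s').
Proof.
elim: s c => [//|i s IHs] c /=; rewrite addn_eq0 negb_and => /orP[/IHs[s' cs' ss']|].
  exists (i :: s') => //; rewrite -(perm_cons i) in ss'.
  by apply: perm_trans ss' _; rewrite -[i :: k :: s']/([:: i; k] ++ s')
    -[k :: i :: s']/([:: k; i] ++ s') perm_cat2r (perm_catC [:: i] [:: k]).
by case: (k =P i) => [-> |//]; rewrite mul1n; exists s.
Qed.

Lemma matchings_perm l s : matchings l s != 0 -> perm_eq s l.
Proof.
elim: l s => [|k l IHl] s /=; first by case: s.
by move=> /occurrences_perm[s' /IHl s'l]; rewrite -(perm_cons k) in s'l;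
  move=> /perm_trans; apply.
Qed.

Lemma matchings_gt0 l : 0 < matchings l l.
Proof. by elim: l => //= k l IHl; rewrite eqxx mul1n ltn_addl. Qed.

End Matchings.

(** * The Magnus cocycle *)

Section Magnus.
Local Open Scope ring_scope.
Variables (K : fieldType) (r : nat).
Notation F := (free_group 'I_r).
Notation tensor := (seq 'I_r -> K^o).
Notation form := ('I_r -> tensor).
Variable t : F -> 'rV[K]_r.
Hypothesis tM : forall g h : F, t (g * h)%g = t g + t h.

Definition lowf n (x : form) := forall i, low n (x i).

Definition translate_form (u : 'rV[K]_r) (x : form) : form :=
  fun i => translate u (x i).

Lemma translate_form_linear u : linear (translate_form u).
Proof. by move=> a x y; apply/funext => i; rewrite /translate_form linearP. Qed.
HB.instance Definition _ u := GRing.isLinear.Build K form form _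
  (translate_form u) (@translate_form_linear u).

Definition translate_op u (op : tensor -> form) : tensor -> form :=
  translate_form u \o op.

Lemma translate_op_linear u : linear (translate_op u).
Proof.
by move=> a x y; apply/funext => tau; rewrite /translate_op /= linearP.
Qed.
HB.instance Definition _ u := GRing.isLinear.Build K (tensor -> form)
  (tensor -> form) _ (translate_op u) (@translate_op_linear u).

Lemma translate_form0 x : translate_form 0 x = x.
Proof. by apply/funext => i; exact: translate0. Qed.

Lemma translate_formD u v x :
  translate_form (u + v) x = translate_form u (translate_form v x).
Proof. by apply/funext => i; exact: translateD. Qed.

Lemma t1 : t 1%g = 0.
Proof.
by have := tM 1%g 1%g; rewrite mulg1 => /eqP; rewrite -subr_eq subrr eq_sym => /eqP.
Qed.

Lemma tV g : t g^-1%g = - t g.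
Proof. by apply/eqP; rewrite -addr_eq0 -tM mulVg t1. Qed.

(** The cocycle is constructed with operators on tensors as values rather than
    with their values at the unit tensor: this yields at once the linear maps
    needed to describe the action of endomorphisms of F. *)
Lemma magnus_exists : exists D : F -> tensor -> form,
  (forall k, D (gen k) = fun tau i => t (gen k) ord0 i *: tau) /\
  forall g h, D (g * h)%g = D g + translate_op (t g) (D h).
Proof.
apply: (@crossed_hom_exists _ _ (fun g => translate_op (t g))) => [g h e|e].
  by apply/funext => tau; rewrite tM; exact: translate_formD.
by apply/funext => tau; rewrite t1; exact: translate_form0.
Qed.

Definition magnus_op : F -> tensor -> form := sval (cid magnus_exists).

Definition magnus (g : F) : form := magnus_op g (@unit_tensor K r).

Lemma magnus_op_gen k tau i : magnus_op (gen k) tau i = t (gen k) ord0 i *: tau.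
Proof. by rewrite /magnus_op; case: cid => D /= [-> _]. Qed.

Lemma magnus_opM g h tau : magnus_op (g * h)%g tau =
  magnus_op g tau + translate_form (t g) (magnus_op h tau).
Proof. by rewrite /magnus_op; case: cid => D /= [_ ->]. Qed.

Lemma magnus_op1 tau : magnus_op 1%g tau = 0.
Proof.
have := magnus_opM 1%g 1%g tau; rewrite mulg1 t1 translate_form0 => /eqP.
by rewrite -subr_eq subrr eq_sym => /eqP.
Qed.

Lemma magnus_opV g tau :
  magnus_op g^-1%g tau = - translate_form (- t g) (magnus_op g tau).
Proof. by apply/eqP; rewrite -addr_eq0 -tV -magnus_opM mulVg magnus_op1. Qed.

(** True of scalar multiplications, hence of all the values of the cocycle,
    because the group acts through translations, which commute. *)
Lemma magnus_op_translate g u tau :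
  magnus_op g (translate u tau) = translate_form u (magnus_op g tau).
Proof.
have comm v x : translate_form v (translate_form u x)
    = translate_form u (translate_form v x).
  by rewrite -!translate_formD addrC.
have gen_comm k : magnus_op (gen k) (translate u tau)
    = translate_form u (magnus_op (gen k) tau).
  by apply/funext => i; rewrite /translate_form !magnus_op_gen linearZ.
move: g; apply: free_group_ind => [|k g IH|k g IH].
- by rewrite !magnus_op1 linear0.
- by rewrite !magnus_opM linearD /= gen_comm IH comm.
by rewrite !magnus_opM !magnus_opV linearD linearN /= gen_comm IH !comm.
Qed.

Lemma magnus_op_linear g : linear (magnus_op g).
Proof.
move=> a x y.
have gen_lin k : magnus_op (gen k) (a *: x + y)
    = a *: magnus_op (gen k) x + magnus_op (gen k) y.
  apply/funext => i; apply/funext => s.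
  by rewrite !fctE !magnus_op_gen !fctE !regE mulrDr mulrCA.
move: g; apply: free_group_ind => [|k g IH|k g IH].
- by rewrite !magnus_op1 scaler0 addr0.
- by rewrite !magnus_opM IH gen_lin linearP /= scalerDr addrACA.
rewrite !magnus_opM !magnus_opV IH gen_lin !linearP /=.
by rewrite scalerDr addrACA.
Qed.
HB.instance Definition _ g := GRing.isLinear.Build K tensor form _
  (magnus_op g) (@magnus_op_linear g).

(** Translations do not change leading coefficients, so there the cocycle
    becomes additive. *)
Lemma magnus_op_lead n g tau i s : low n tau -> (size s <= n)%N ->
  magnus_op g tau i s = t g ord0 i * tau s.
Proof.
move=> lt; move: g s; pose Q g := forall s, (size s <= n)%N ->
  magnus_op g tau i s = t g ord0 i * tau s.
have lowQ g : Q g -> low n (magnus_op g tau i).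
  by move=> Qg s ls; rewrite Qg ?lt ?mulr0 // ltnW.
have Qgen k : Q (gen k) by move=> s ls; rewrite magnus_op_gen.
apply: free_group_ind => [|k g IH|k g IH] s ls.
- by rewrite magnus_op1 t1 mxE mul0r.
- rewrite magnus_opM tM mxE mulrDl fctE; congr (_ + _) => //; first exact: Qgen.
  by rewrite /translate_form (translate_lead _ (lowQ _ IH)) ?IH.
rewrite magnus_opM tM mxE mulrDl magnus_opV tV !mxE !fctE /translate_form.
rewrite (translate_lead _ (lowQ _ IH)) ?(translate_lead _ (lowQ _ (Qgen k))) //.
by rewrite IH // Qgen // mulNr.
Qed.

Lemma magnusM g h : magnus (g * h)%g = magnus g + translate_form (t g) (magnus h).
Proof. exact: magnus_opM. Qed.

End Magnus.

(** * The action of an endomorphism on the cocycle *)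

Section Semilinear.
Local Open Scope ring_scope.
Variables (K : fieldType) (r : nat).
Notation F := (free_group 'I_r).
Notation tensor := (seq 'I_r -> K^o).
Notation form := ('I_r -> tensor).
Variable t : F -> 'rV[K]_r.
Hypothesis tM : forall g h : F, t (g * h)%g = t g + t h.
Variables (P M : 'M[K]_r).
Hypothesis PQ : P *m (\matrix_k t (gen k)) = 1%:M.
Variable phi : F -> F.
Hypothesis phiM : {morph phi : g h / (g * h)%g}.
Hypothesis phi_t : forall g, t (phi g) = t g *m M.

Notation mag := (magnus tM).
Notation mag_op := (magnus_op tM).

Lemma sum_row_gen k : \sum_l P k l *: t (gen l) = delta_mx ord0 k.
Proof.
rewrite -[delta_mx _ _]mulmx1 -PQ mulmxA -rowE mulmx_sum_row.
by apply: eq_bigr => l _; rewrite !mxE rowK.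
Qed.

Lemma sum_gen_col k l : \sum_i t (gen k) ord0 i * P i l = (k == l)%:R.
Proof.
have /matrixP/(_ k l) := mulmx1C PQ; rewrite !mxE => <-.
by apply: eq_bigr => i _; rewrite !mxE.
Qed.

(** The linear map through which phi acts on the cocycle. The unit tensor times
    t (gen k) has to go to the value at phi (gen k), and the matrix P expresses
    the basis vectors through the vectors t (gen k). *)
Definition pullback (x : form) : form :=
  \sum_i \sum_k P i k *: mag_op (phi (gen k)) (substitute M (x i)).

Lemma pullback_linear : linear pullback.
Proof.
move=> a x y; rewrite /pullback scaler_sumr -big_split; apply: eq_bigr => i _.
rewrite scaler_sumr -big_split; apply: eq_bigr => k _.
rewrite substitute_linear magnus_op_linear scalerDr !scalerA.
by rewrite (mulrC a).
Qed.
HB.instance Definition _ :=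
  GRing.isLinear.Build K form form _ pullback pullback_linear.

Lemma pullback_translate u x :
  pullback (translate_form u x) = translate_form (u *m M) (pullback x).
Proof.
rewrite /pullback [translate_form _ (\sum_i _)]linear_sum; apply: eq_bigr => i _.
rewrite [RHS]linear_sum; apply: eq_bigr => k _.
by rewrite substitute_translate magnus_op_translate [RHS]linearZ.
Qed.

Lemma magnus_gen k i : mag (gen k) i = t (gen k) ord0 i *: unit_tensor K (r := r).
Proof. exact: magnus_op_gen. Qed.

(** Both sides are crossed homomorphisms for the action of g by the translation
    along t (phi g), and they agree on generators. *)
Lemma pullback_magnus g : pullback (mag g) = mag (phi g).
Proof.
move: g; apply: (@crossed_hom_unique 'I_r form
  (fun g => translate_form (t (phi g)) : {additive form -> form})).
- by move=> g h x; rewrite phiM tM; exact: translate_formD.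
- by move=> x; rewrite phi_t (t1 tM) mul0mx; exact: translate_form0.
- by move=> g h; rewrite magnusM linearD /= pullback_translate phi_t.
- by move=> g h; rewrite phiM magnusM.
move=> k; rewrite /pullback exchange_big /= (bigD1 k) //=.
have E l : \sum_i P i l *: mag_op (phi (gen l)) (substitute M (mag (gen k) i))
    = (k == l)%:R *: mag (phi (gen l)).
  rewrite -sum_gen_col scaler_suml; apply: eq_bigr => i _.
  by rewrite magnus_gen [substitute _ _]linearZ /= substitute_unit
    [mag_op _ _]linearZ scalerA mulrC.
rewrite E eqxx scale1r big1 ?addr0 // => l lk.
by rewrite E eq_sym (negbTE lk) scale0r.
Qed.

(** The first index of a form and those of its coefficients, read together. *)
Definition flat (x : form) : tensor := fun s => if s is i :: s' then x i s' else 0.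

(** In leading degree the words phi (gen k) only count through their exponent
    sums, and the base change by P cancels. *)
Lemma pullback_lead n x j s : lowf n x -> (size s <= n)%N ->
  pullback x j s = substitute M (flat x) (j :: s).
Proof.
move=> lx ls; rewrite /pullback !fct_sumE /=; apply: eq_bigr => i _.
have -> : M i j = \sum_k P i k * t (phi (gen k)) ord0 j.
  have <- : (P *m (\matrix_k t (gen k)) *m M) i j = M i j by rewrite PQ mul1mx.
  rewrite -mulmxA mxE; apply: eq_bigr => k _.
  by rewrite phi_t !mxE; congr (_ * _); apply: eq_bigr => l _; rewrite mxE.
rewrite !fct_sumE mulr_suml; apply: eq_bigr => k _.
rewrite !fctE regE (magnus_op_lead tM _ _ (low_substitute M (lx i))) //.
by rewrite mulrA.
Qed.

Lemma pullback_low n x : lowf n x -> lowf n (pullback x).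
Proof.
move=> lx j s ls; rewrite (pullback_lead _ lx) /=; last exact: ltnW.
by apply: big1 => k _; rewrite (low_substitute M (lx k)) ?mulr0.
Qed.

(** * Leading coefficients of iterated commutators *)

Inductive kernel_span : form -> Prop :=
| kernel_span_magnus m : t m = 0 -> kernel_span (mag m)
| kernel_span_linear a x y :
    kernel_span x -> kernel_span y -> kernel_span (a *: x + y).

Lemma kernel_span0 : kernel_span 0.
Proof.
have := kernel_span_magnus (t1 tM).
by rewrite [mag 1%g](magnus_op1 tM (unit_tensor K (r := r))).
Qed.

Lemma kernel_spanZ a x : kernel_span x -> kernel_span (a *: x).
Proof.
by move=> kx; rewrite -[_ *: _]addr0; apply: kernel_span_linear kernel_span0.
Qed.

Lemma kernel_spanB x y : kernel_span x -> kernel_span y -> kernel_span (x - y).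
Proof.
by move=> kx ky; rewrite addrC -scaleN1r; exact: kernel_span_linear.
Qed.

Lemma kernel_span_sum (a : 'I_r -> K) (x : 'I_r -> form) :
  (forall i, kernel_span (x i)) -> kernel_span (\sum_i a i *: x i).
Proof.
move=> kx; apply: big_ind; [exact: kernel_span0| |].
  by move=> y z ky kz; rewrite -[y]scale1r; exact: kernel_span_linear.
by move=> i _; exact: kernel_spanZ.
Qed.

(** Translating the value at m amounts to conjugating m. *)
Lemma kernel_span_translate g x :
  kernel_span x -> kernel_span (translate_form (t g) x).
Proof.
elim=> [m tm|a y z _ IHy _ IHz]; last first.
  by rewrite translate_form_linear; exact: kernel_span_linear.
have -> : translate_form (t g) (mag m) = mag (g * m * g^-1)%g.
  rewrite !magnusM tM tm addr0.
  have := magnusM tM g g^-1%g; rewrite mulgV.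
  rewrite [mag 1%g](magnus_op1 tM (unit_tensor K (r := r))) => e.
  by rewrite addrAC -e add0r.
by apply: kernel_span_magnus; rewrite !tM tm addr0 (tV tM) subrr.
Qed.

(** A combination of difference operators that, by translate_diff, derives
    leading coefficients in the k-th basis direction, one degree higher. *)
Definition direction k (x : form) : form :=
  \sum_l P k l *: (translate_form (t (gen l)) x - x).

Lemma kernel_span_direction k x : kernel_span x -> kernel_span (direction k x).
Proof.
move=> kx; apply: kernel_span_sum => l; apply: kernel_spanB => //.
exact: kernel_span_translate.
Qed.

Lemma direction_lead n k x i s : lowf n x -> (size s <= n.+1)%N ->
  direction k x i s = derivation (delta_mx ord0 k) (x i) s.
Proof.
move=> lx ls; rewrite -sum_row_gen derivation_suml /direction !fct_sumE.
by apply: eq_bigr => l _; rewrite -(translate_diff _ (lx i)).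
Qed.

(** The unit tensor in position c, and zero in the other positions. *)
Definition basis_form (c : 'I_r) : form := \sum_l P c l *: mag (gen l).

Lemma basis_formE c i : basis_form c i = (i == c)%:R *: unit_tensor K (r := r).
Proof.
have := sum_row_gen c => /rowP/(_ i); rewrite mxE eqxx /= summxE eq_sym => <-.
rewrite /basis_form fct_sumE scaler_suml; apply: eq_bigr => l _.
by rewrite mxE -scalerA -magnus_gen.
Qed.

Lemma magnus_commutator g h :
  mag (g * h * (h * g)^-1)%g = (translate_form (t g) (mag h) - mag h)
    - (translate_form (t h) (mag g) - mag g).
Proof.
have: mag (g * h)%g = mag (g * h * (h * g)^-1)%g + mag (h * g)%g.
  rewrite -[in LHS](mulgVK (h * g)%g (g * h)%g) magnusM !tM (tV tM) tM.
  by rewrite [t h + t g]addrC subrr translate_form0.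
move=> /esym/(canRL (addrK _)) ->; rewrite !magnusM.
by rewrite opprB opprD [RHS]addrACA [in RHS](addrC _ (mag g)).
Qed.

(** The extension of the commutator formula from generators to basis vectors,
    by bilinearity. *)
Lemma kernel_span_basis b c :
  kernel_span (direction b (basis_form c) - direction c (basis_form b)).
Proof.
have -> : direction b (basis_form c) - direction c (basis_form b) =
    \sum_k P b k *: \sum_l P c l *: mag (gen k * gen l * (gen l * gen k)^-1)%g.
  have E c' b' : direction b' (basis_form c') = \sum_k P b' k *: \sum_l P c' l *:
      (translate_form (t (gen k)) (mag (gen l)) - mag (gen l)).
    rewrite /direction; apply: eq_bigr => k _; congr (_ *: _).
    rewrite /basis_form [translate_form _ _]linear_sum -sumrB.
    by apply: eq_bigr => l _; rewrite linearZ scalerBr.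
  rewrite !E; under [X in _ - X]eq_bigr do rewrite scaler_sumr.
  rewrite exchange_big /= -sumrB; apply: eq_bigr => k _.
  rewrite !scaler_sumr -sumrB; apply: eq_bigr => l _.
  by rewrite magnus_commutator !scalerA [P c l * _]mulrC -scalerBr.
apply: kernel_span_sum => k; apply: kernel_span_sum => l.
by apply: kernel_span_magnus; rewrite !tM (tV tM) tM [t (gen l) + _]addrC subrr.
Qed.

(** The element is obtained from the one of kernel_span_basis by applying the
    directions listed in us; in leading degree they act as exact derivations, so
    that they can be iterated. *)
Lemma kernel_span_leading (us : seq 'I_r) b c : exists x, kernel_span x /\
  lowf (size us).+1 x /\
  forall i s, size s = (size us).+1 ->
    x i s = (i == c)%:R * (matchings (us ++ [:: b]) s)%:R
            - (i == b)%:R * (matchings (us ++ [:: c]) s)%:R.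
Proof.
elim: us => [|k us [x [kx [lx xE]]]].
  exists (direction b (basis_form c) - direction c (basis_form b)).
  have lb d : lowf 0 (basis_form d) by move=> i s.
  have dE d d' i s : (size s <= 1)%N -> direction d (basis_form d') i s =
      (i == d')%:R * (matchings [:: d] s)%:R.
    move=> ls; rewrite (direction_lead _ _ (lb d')) // basis_formE linearZ /=.
    by rewrite fctE -(derivation_delta K).
  split; first exact: kernel_span_basis.
  split=> [i|i] s ls; rewrite !fctE !dE // ?ls ?(ltnW ls) //.
  by case: s ls => //; rewrite !mulr0 subrr.
exists (direction k x); split; first exact: kernel_span_direction.
split=> [i|i] s ls; rewrite (direction_lead _ _ lx) ?ls ?(ltnW ls) //.
  exact: derivation_low (lx i) _.
pose m l : tensor := fun s => (matchings (us ++ l) s)%:R.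
transitivity (derivation (delta_mx ord0 k)
    ((i == c)%:R *: m [:: b] - (i == b)%:R *: m [:: c]) s).
  by apply: eq_derivation => s'; rewrite ls => -[/esym ls']; rewrite xE.
have dZ a l : derivation (delta_mx ord0 k) (a *: m l) s
    = a * (matchings ((k :: us) ++ l) s)%:R.
  by rewrite linearZ; congr (_ * _); exact: derivation_delta.
by rewrite linearB /= -!dZ.
Qed.

End Semilinear.

(** * The invariant map on the commutator subgroup *)

Section Truncation.
Local Open Scope ring_scope.
Variables (K : fieldType) (r n : nat).
Notation tensor := (seq 'I_r -> K^o).
Notation form := ('I_r -> tensor).

Definition truncated := {ffun 'I_r * {bseq n of 'I_r} -> K^o}.

Definition truncate (x : form) : truncated := [ffun j => x j.1 (val j.2)].

Definition extend (e : truncated) : form :=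
  fun i s => if insub s is Some b then e (i, b) else 0.

Lemma truncate_linear : linear truncate.
Proof. by move=> a x y; apply/ffunP => j; rewrite !ffunE. Qed.
HB.instance Definition _ :=
  GRing.isLinear.Build K form truncated _ truncate truncate_linear.

Lemma extend_linear : linear extend.
Proof.
move=> a x y; apply/funext => i; apply/funext => s; rewrite !fctE /extend.
by case: insub => [b|]; rewrite ?ffunE // scaler0 addr0.
Qed.
HB.instance Definition _ :=
  GRing.isLinear.Build K truncated form _ extend extend_linear.

Lemma extendK : cancel extend truncate.
Proof.
by move=> e; apply/ffunP => -[i b]; rewrite ffunE /extend /= valK.
Qed.

Lemma truncateK x i s : (size s <= n)%N -> extend (truncate x) i s = x i s.
Proof.
move=> ls; rewrite /extend; case: insubP => [b _ <-|]; last by rewrite ls.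
by rewrite ffunE.
Qed.

End Truncation.

Section InvariantMap.
Local Open Scope ring_scope.
Variables (K : numFieldType) (r : nat).
Notation F := (free_group 'I_r).
Notation tensor := (seq 'I_r -> K^o).
Notation form := ('I_r -> tensor).
Variable t : F -> 'rV[K]_r.
Hypothesis tM : forall g h : F, t (g * h)%g = t g + t h.
Variables (P M : 'M[K]_r).
Hypothesis PQ : P *m (\matrix_k t (gen k)) = 1%:M.
Variable phi : F -> F.
Hypothesis phiM : {morph phi : g h / (g * h)%g}.
Hypothesis phi_t : forall g, t (phi g) = t g *m M.
Hypothesis Mtrig : is_trig_mx M.

Variables (us : seq 'I_r) (b c : 'I_r).
Hypothesis bc : b != c.
Let target := us ++ [:: b; c].
Hypothesis target_prod : \prod_(i <- target) M i i = 1.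

Let n := (size us).+1.
Let weight (s : seq 'I_r) : nat := (\sum_(i <- s) i)%N.
Let E : vectType K := truncated K r n.
Let res : form -> E := @truncate K r n.
Let ext : E -> form := @extend K r n.
Let pull := pullback tM P M phi.
Let C : 'End(E) := linfun (res \o pull \o ext).

(* Truncation is compatible with pull since the value of pull x in degrees at
   most n only depends on x in these degrees. *)
Let CE x : C (res x) = res (pull x).
Proof.
rewrite lfunE /=; apply/eqP; rewrite -subr_eq0 -!linearB /=; apply/eqP.
apply/ffunP => -[i [s ls]]; rewrite !ffunE.
apply: (pullback_low tM PQ phi_t (n := n.+1)) => // {}i {ls}s ls.
by rewrite !fctE (truncateK _ _ ls) subrr.
Qed.

(** The support allowed for the forms in the stable subspace S: leading
    coefficients of weight below that of the target. *)
Let in_step (i : 'I_r) (s : seq 'I_r) : bool :=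
  (size s == n) && (weight (i :: s) < weight target)%N.

Let mask (e : E) : E := [ffun j => if in_step j.1 (val j.2) then 0 else e j].

Let mask_linear : linear mask.
Proof.
move=> a x y; apply/ffunP => j; rewrite !ffunE.
by case: ifP => // _; rewrite scaler0 addr0.
Qed.
HB.instance Definition _ := GRing.isLinear.Build K E E _ mask mask_linear.

Let S : {vspace E} := lker (linfun mask).

Let mem_step x : (forall i s, (size s <= n)%N -> ~~ in_step i s -> x i s = 0) <->
  res x \in S.
Proof.
rewrite memv_ker lfunE /=; split=> [h|/eqP/ffunP h i s ls ni].
  apply/eqP/ffunP => -[i [s ls]]; rewrite !ffunE /=.
  by case: ifPn => // ni; exact: h.
by have := h (i, Bseq ls); rewrite !ffunE /= (negbTE ni).
Qed.

Let step_low x : res x \in S -> lowf n x.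
Proof. by move=> /mem_step xS i s ls; rewrite xS ?(ltnW ls) // /in_step ltn_eqF. Qed.

(* On forms without leading coefficients of weight above the target, the
   action on those of the target weight is diagonal. *)
Let pull_diag x j s : lowf n x ->
  (forall i s, size s = n -> (weight target < weight (i :: s))%N -> x i s = 0) ->
  size s = n -> (weight target <= weight (j :: s))%N ->
  pull x j s = \prod_(i <- j :: s) M i i * x j s.
Proof.
move=> lx hx ss le; rewrite /pull (pullback_lead tM PQ phi_t _ lx) ?ss //.
rewrite (substitute_trig Mtrig) // => -[//|i s'] [ss'] lt /=.
by apply: hx; [rewrite ss' ss|exact: leq_ltn_trans le lt].
Qed.

Let step_stable : (C @: S <= S)%VS.
Proof.
apply/subvP => _ /memv_imgP[e eS ->]; rewrite -[e]extendK CE.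
rewrite -[e]extendK in eS; have lx := step_low eS; move/mem_step in eS.
apply/mem_step => i s ls; rewrite negb_and -leqNgt => nis.
case: (ltngtP (size s) n) ls nis => // [ls _ _|ss _ /= le].
  exact: (pullback_low tM PQ phi_t lx).
rewrite pull_diag // => [|k s' ss' lt].
  by rewrite eS ?mulr0 ?ss // negb_and -leqNgt le orbT.
by rewrite eS ?ss' // negb_and -leqNgt ltnW ?orbT.
Qed.

Let ker_space := span_of_family (fun m : F => t m = 0) (fun m => res (magnus tM m)).

(* The leading coefficients at the permutations of the target are multiplied
   by target_prod, so x is fixed modulo S. *)
Let eigen_not_onto (W : {vspace E}) :
  (forall m, t m = 0 -> res (magnus tM m) \in W) ->
  (forall U : {vspace E}, (forall m, t m = 0 -> res (magnus tM m) \in U) ->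
     (W <= U)%VS) ->
  ~~ (W <= (\1%VF - C) @: W)%VS.
Proof.
move=> fW minW; have [x [kx [lx xE]]] := kernel_span_leading tM PQ us b c.
have x_perm i s : size s = n -> x i s != 0 -> perm_eq (i :: s) target.
  move=> ss; rewrite xE //; case: (altP (i =P c)) => [->|ic].
    rewrite [c == b]eq_sym (negbTE bc) mul0r subr0 mul1r pnatr_eq0 => /matchings_perm.
    rewrite -(perm_cons c) => /perm_trans; apply.
    by rewrite -cat1s perm_catC /target -catA.
  case: (altP (i =P b)) => [->|ib]; last by rewrite !mul0r subrr eqxx.
  rewrite mul0r sub0r mul1r oppr_eq0 pnatr_eq0 => /matchings_perm.
  rewrite -(perm_cons b) => /perm_trans; apply.
  by rewrite -cat1s perm_catCA /target perm_cat2l.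
have perm_weight s s' : perm_eq s s' -> weight s = weight s'.
  by move=> ss; rewrite /weight (perm_big _ ss).
have x_big i s : size s = n -> (weight target < weight (i :: s))%N -> x i s = 0.
  move=> ss lt; apply/eqP/negPn/negP => /(x_perm i s ss)/perm_weight e.
  by rewrite e ltnn in lt.
apply: (@fixed_mod_not_onto _ _ C W S (res x)) => //.
- have /minW sub m : t m = 0 -> res (magnus tM m) \in (C @^-1: W)%VS.
    move=> tm; rewrite -memv_preim CE /pull (pullback_magnus _ PQ) //.
    by apply: fW; rewrite phi_t tm mul0mx.
  apply/subvP => _ /memv_imgP[e eW ->]; rewrite memv_preim.
  exact: subvP sub _ eW.
- elim: kx => [m tm|a y z _ IHy _ IHz]; first exact: fW.
  by rewrite /res linearP rpredD // rpredZ.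
- apply/negP => /mem_step/(_ c (us ++ [:: b])).
  rewrite size_cat addn1 leqnn => /(_ isT); rewrite /in_step.
  rewrite (perm_weight (c :: us ++ [:: b]) target); last first.
    by rewrite -cat1s perm_catC /target -catA.
  rewrite ltnn andbF xE ?size_cat ?addn1 // eqxx [c == b]eq_sym (negbTE bc).
  move=> /(_ isT)/eqP; rewrite mul0r subr0 mul1r pnatr_eq0.
  by have := matchings_gt0 (us ++ [:: b]); case: matchings.
rewrite CE /res -linearB; apply/mem_step => i s ls; rewrite negb_and -leqNgt !fctE.
case: (ltngtP (size s) n) ls => // [ls _ _|ss _ /= le].
  by rewrite lx // /pull (pullback_low tM PQ phi_t lx) ?subrr.
rewrite pull_diag //; case: (eqVneq (x i s) 0) => [->|/(x_perm i s ss) p].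
  by rewrite mulr0 subrr.
by rewrite (perm_big _ p) target_prod mul1r subrr.
Qed.

(** Here the kernel of t plays the role of the commutator subgroup. *)
Lemma invariant_map_exists : exists (E : vectType K) (f : F -> E),
  [/\ forall g h, t g = 0 -> t h = 0 -> f (g * h)%g = f g + f h,
      forall g, t g = 0 -> f (phi g) = f g &
      exists2 m, t m = 0 & f m != 0].
Proof.
have [W [fW minW]] := ker_space; have := eigen_not_onto fW minW.
(* R is a projection with kernel the image of 1 - C. *)
set Z := (_ @: W)%VS => WZ; pose R : 'End(E) := (\1%VF - projv Z)%R.
have RE e : R e = e - projv Z e by rewrite add_lfunE opp_lfunE id_lfunE.
exists E, (fun g => R (res (magnus tM g))); split=> [g h tg _|g tg|].
- by rewrite magnusM tg translate_form0 /res !linearD.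
- rewrite -(pullback_magnus tM PQ phiM phi_t) -/pull -[X in R X = _]CE; apply/eqP.
  rewrite eq_sym -subr_eq0 -linearB /= RE subr_eq0 eq_sym; apply/eqP/projv_id.
  apply/memv_imgP; exists (res (magnus tM g)); first exact: fW.
  by rewrite add_lfunE opp_lfunE id_lfunE.
apply: contrapT => noz; move/negP: WZ; apply; apply: minW => m tm.
case: (eqVneq (R (res (magnus tM m))) 0) => [|nz]; last by case: noz; exists m.
by rewrite RE => /eqP; rewrite subr_eq0 => /eqP ->; exact: memv_proj.
Qed.

End InvariantMap.

(** * Automorphisms of free solvable groups *)

Section InvariantAdditiveMap.
Local Open Scope group_scope.
Local Open Scope quotient_scope.
Local Open Scope classical_set_scope.
Variables (G : groupType) (N : normal_subgroup G).
Variables (phi : {multiplicative quotient_group N -> quotient_group N}).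
Variable lift : G -> G.
Hypothesis lift_pi : forall g,
  \pi_(quotient_group N) (lift g) = phi (\pi_(quotient_group N) g).

(** If m ^+ a = z m ^+ b (phi z)^-1 modulo N, then z lies in H by the hypothesis
    on triples, and applying f yields a f m = b f m. The subgroup H is the whole
    group for invariants of the lattice of exponent sums, and the commutator
    subgroup for the finer ones. *)
Lemma reidemeister_infinite_of_invariant (K : numFieldType) (E : lmodType K)
    (H : set G) (f : G -> E) (m : G) :
  is_subgroup H -> (forall g, N g -> H g -> f g = 0%R) ->
  (forall g h, H g -> H h -> f (g * h) = (f g + f h)%R) ->
  (forall g, H g -> H (lift g) /\ f (lift g) = f g) ->
  (forall x y z, H x -> H y -> N (x^-1 * (z * y * (lift z)^-1)) -> H z) ->
  H m -> f m != 0%R ->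
  reidemeister_number phi = +oo%E.
Proof.
move=> Hs fN fM flift Hz Hm fm.
have hV x : H x -> H x^-1 by exact: subgroupV.
have hM x y : H x -> H y -> H (x * y) by exact: subgroupM.
have f1 : f 1 = 0%R.
  by have := fM _ _ Hs.1 Hs.1; rewrite mulg1 => /eqP;
    rewrite -subr_eq subrr eq_sym => /eqP.
have fV x : H x -> f x^-1 = (- f x)%R.
  by move=> hx; apply/eqP; rewrite -addr_eq0 -fM ?mulVg ?f1 //; exact: hV.
have fX n : H (m ^+ n) /\ f (m ^+ n) = (f m *+ n)%R.
  elim: n => [|n [IH1 IH2]]; first by rewrite expg0 f1; split=> //; exact: Hs.1.
  by rewrite expgS fM // IH2 mulrS; split=> //; exact: hM.
apply: (@reidemeister_number_infinite _ phi
  (fun n => \pi_(quotient_group N) (m ^+ n))) => a b [z].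
have [{}z ->] : exists z', z = \pi_(quotient_group N) z'.
  by exists (repr z); rewrite reprK.
rewrite -lift_pi -pi_inv -(pi_mul N z) -pi_mul => /pi_eqP Nz.
have [[Ha fa] [Hb fb]] := (fX a, fX b).
have hz := Hz _ _ _ Ha Hb Nz; have [hl fl] := flift _ hz.
have hzm := hM _ _ hz Hb; have hlV := hV _ hl; have hzml := hM _ _ hzm hlV.
have := fN _ Nz (hM _ _ (hV _ Ha) hzml).
rewrite fM ?fV //; last exact: hV.
rewrite !fM // fV // fl fa fb addrAC addrN add0r => /eqP.
rewrite addrC subr_eq0 -!scaler_nat -subr_eq0 -scalerBl scaler_eq0 (negbTE fm) orbF.
by rewrite subr_eq0 eqr_nat => /eqP.
Qed.

End InvariantAdditiveMap.

Section Lifts.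
Local Open Scope group_scope.
Local Open Scope quotient_scope.
Variables (r k : nat).
Notation F := (free_group 'I_r).
Notation G := (free_solvable_group r k).
Notation pik := (\pi_(quotient_group (derived_normal F k))).

Lemma morph_eq (H : groupType) (p q : F -> H) :
  {morph p : x y / x * y} -> {morph q : x y / x * y} ->
  (forall i, p (gen i) = q (gen i)) -> p =1 q.
Proof.
move=> pM qM e.
have m1 (s : F -> H) : {morph s : x y / x * y} -> s 1 = 1.
  by move=> sM; apply: (mulgI (s 1)); rewrite -sM !mulg1.
have mV (s : F -> H) x : {morph s : x y / x * y} -> s x^-1 = (s x)^-1.
  by move=> sM; apply: (mulgI (s x)); rewrite -sM !mulgV m1.
apply: free_group_ind => [|i g IH|i g IH]; first by rewrite !m1.
  by rewrite pM qM e IH.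
by rewrite pM qM !mV // e IH.
Qed.

Lemma endo_lift (phi : G -> G) : {morph phi : x y / x * y} ->
  exists lift : F -> F, {morph lift : x y / x * y} /\
    forall g, pik (lift g) = phi (pik g).
Proof.
move=> phiM; have [lift [lgen liftM]] := free_lift (fun i => repr (phi (pik (gen i)))).
exists lift; split=> //; apply: morph_eq => [x y|x y|i].
- by rewrite liftM pi_mul.
- by rewrite -phiM (pi_mul _ x y).
by rewrite lgen reprK.
Qed.

Lemma ab_endo (lift : F -> F) : {morph lift : x y / x * y} ->
  exists A : 'M[int]_r, forall g, ab (lift g) = (ab g *m A)%R.
Proof.
move=> liftM; exists (\matrix_i ab (lift (gen i)))%R.
apply: (@crossed_hom_unique _ _ (fun=> idfun)) => // [g h|g h|i].
- by rewrite liftM abM.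
- by rewrite abM mulmxDl.
by rewrite ab_gen -rowE rowK.
Qed.

Lemma ab_matrix_inj (A B : 'M[int]_r) :
  (forall g : F, ab g *m A = ab g *m B)%R -> A = B.
Proof. by move=> e; apply/row_matrixP => i; rewrite !rowE -!ab_gen e. Qed.

(** The inverse of phi lifts to the free group as well; the two lifts compose to
    the identity modulo commutators, so their matrices are inverse to each other
    over the integers. *)
Lemma det_ab_auto (phi : G -> G) (lift : F -> F) (A : 'M[int]_r) :
  (0 < k)%N -> {morph phi : x y / x * y} -> bijective phi ->
  (forall g, pik (lift g) = phi (pik g)) ->
  (forall g, ab (lift g) = (ab g *m A)%R) -> (\det A ^+ 2 = 1)%R.
Proof.
move=> k0 phiM [psi phiK psiK] liftP abA.
have psiM : {morph psi : x y / x * y}.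
  by move=> x y; apply: (can_inj phiK); rewrite phiM !psiK.
have [lift' [lift'M lift'P]] := endo_lift psiM.
have [B abB] := ab_endo lift'M.
have AB : (A *m B = 1%:M)%R.
  apply: ab_matrix_inj => g; rewrite mulmxA -abA -abB mulmx1.
  have : pik (lift' (lift g)) = pik g by rewrite lift'P liftP phiK.
  move=> /pi_eqP/(derived_series_anti k0)/ab_derived.
  by rewrite abM abV addrC => /eqP; rewrite subr_eq0 => /eqP.
have := congr1 (fun X : 'M[int]_r => absz (\det X)%R) AB.
rewrite det_mulmx det1 abszM => /eqP.
rewrite muln_eq1 => /andP[/eqP d1 _].
by rewrite -[(_ ^+ 2)%R]ger0_norm ?sqr_ge0 // normrX -abszE d1 expr1n.
Qed.

End Lifts.

Section FreeSolvable.
Local Open Scope group_scope.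
Local Open Scope quotient_scope.
Variable r : nat.
Hypothesis r_gt1 : (1 < r)%N.
Notation F := (free_group 'I_r).
Notation K := algC.

Let t0 (g : F) : 'rV[K]_r := map_mx intr (ab g).

Let t0M g h : t0 (g * h) = (t0 g + t0 h)%R.
Proof. by rewrite /t0 abM map_mxD. Qed.

Let t0_eq0 g : t0 g = 0%R -> ab g = 0%R.
Proof.
move=> /rowP h; apply/rowP => i; have /eqP := h i.
by rewrite !mxE intr_eq0 => /eqP.
Qed.

Let t0_gen i : t0 (gen i) = delta_mx ord0 i.
Proof. by rewrite /t0 ab_gen map_delta_mx. Qed.

Lemma twice_each_split (b c : 'I_r) : b != c ->
  exists us, perm_eq (us ++ [:: b; c]) (enum 'I_r ++ enum 'I_r).
Proof.
move=> bc; pose e := enum 'I_r ++ enum 'I_r.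
have be : b \in e by rewrite mem_cat mem_enum.
have ce : c \in rem b e.
  have ce : c \in e by rewrite mem_cat mem_enum.
  have := perm_mem (perm_to_rem be) c; rewrite ce inE eq_sym (negbTE bc).
  by move=> /= <-.
exists (rem c (rem b e)); rewrite perm_catC perm_sym.
by apply: perm_trans (perm_to_rem be) _; rewrite perm_cons perm_to_rem.
Qed.

(** In a basis where A is triangular, the eigenvalue attached to a word is the
    product of the diagonal entries at its letters; for the word in which each
    letter occurs twice, it is det A ^ 2. *)
Lemma commutator_invariant (lift : F -> F) (A : 'M[int]_r) :
  {morph lift : x y / x * y} -> (forall g, ab (lift g) = (ab g *m A)%R) ->
  (\det A ^+ 2 = 1)%R ->
  exists (E : vectType K) (f : F -> E),
  [/\ forall g h, ab g = 0%R -> ab h = 0%R -> f (g * h) = (f g + f h)%R,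
      forall g, ab g = 0%R -> f (lift g) = f g &
      exists2 m, ab m = 0%R & f m != 0%R].
Proof.
move=> liftM abA detA; pose A' : 'M[K]_r := map_mx intr A.
have [Pm /unitarymx_unit Pu Ttrig] := Schur A' (ltnW r_gt1).
have {}Ttrig : is_trig_mx (Pm *m A' *m invmx Pm)%R by rewrite -conjumx.
set T := (Pm *m A' *m invmx Pm)%R in Ttrig.
(* The exponent sums in the coordinates in which A is triangular. *)
pose t (g : F) : 'rV[K]_r := (t0 g *m invmx Pm)%R.
have tM g h : t (g * h) = (t g + t h)%R by rewrite /t t0M mulmxDl.
have PQ : (Pm *m (\matrix_k t (gen k)) = 1%:M)%R.
  rewrite (_ : (\matrix_k _)%R = invmx Pm) ?mulmxV //; apply/row_matrixP => i.
  by rewrite rowK /t t0_gen -rowE.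
have t_lift g : t (lift g) = (t g *m T)%R.
  by rewrite /t /T /t0 abA map_mxM !mulmxA mulmxKV.
have t_eq0 g : t g = 0%R <-> ab g = 0%R.
  split=> [tg|ag]; last by rewrite /t /t0 ag map_mx0 mul0mx.
  by apply: t0_eq0; rewrite -[t0 g](mulmxKV Pu) -/(t g) tg mul0mx.
pose b : 'I_r := Ordinal (ltnW r_gt1); pose c : 'I_r := Ordinal r_gt1.
have bc : b != c by [].
have [us us_perm] := twice_each_split bc.
have prod1 : (\prod_(i <- us ++ [:: b; c]) T i i = 1)%R.
  rewrite (perm_big _ us_perm) big_cat /= !big_enum -expr2 /=.
  rewrite -(det_trig Ttrig) /T !det_mulmx det_inv mulrC mulKr -?unitmxE //.
  by rewrite /A' det_map_mx -rmorphXn detA.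
have [E [f [fM fl [m tm fm]]]] := invariant_map_exists tM PQ liftM t_lift Ttrig bc prod1.
exists E, f; split=> [g h /t_eq0 tg /t_eq0 th|g /t_eq0 tg|].
- exact: fM.
- exact: fl.
by exists m => //; exact/t_eq0.
Qed.

Lemma free_solvable_R_infty k : (2 <= k)%N -> R_infty (free_solvable_group r k).
Proof.
move=> k2 phi phi_bij; have phiM : {morph phi : x y / x * y} by exact: gmulfM.
have [lift [liftM liftP]] := endo_lift phiM.
have [A abA] := ab_endo liftM.
have k0 : (0 < k)%N by exact: ltnW.
have detA := det_ab_auto k0 phiM phi_bij liftP abA.
have abN g : derived_normal F k g -> ab g = 0%R.
  by move=> /(derived_series_anti k0)/ab_derived.
pose A' : 'M[K]_r := map_mx intr A.
have t0_lift g : t0 (lift g) = (t0 g *m A')%R by rewrite /t0 abA map_mxM.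
case: (eqVneq (\det (A' - 1%:M))%R 0%R) => [/eqP det0|det_neq0].
  have /det0P[v v0 vA] : (\det (A' - 1%:M)^T == 0)%R by rewrite det_tr.
  have {}vA : (A' *m v^T = v^T)%R.
    apply/eqP; rewrite -subr_eq0 -[X in (_ - X)%R]mul1mx -mulmxBl.
    by rewrite -[(A' - 1%:M)%R]trmxK -trmx_mul vA trmx0.
  have [i vi] : exists i, v ord0 i != 0%R.
    by apply/existsP; apply: contraNT v0 => /existsPn h; apply/eqP/rowP => i;
      rewrite mxE; apply/eqP/negPn.
  pose f (g : F) : K^o := ((t0 g *m v^T) ord0 ord0)%R.
  have fM g h : f (g * h) = (f g + f h)%R by rewrite /f t0M mulmxDl mxE.
  apply: (@reidemeister_infinite_of_invariant _ _ phi lift liftP K K^o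
    setT f (gen i)) => //; last by rewrite /f t0_gen -rowE !mxE.
  - by move=> g /abN g0 _; rewrite /f /t0 g0 map_mx0 mul0mx mxE.
  - by move=> g h _ _; exact: fM.
  by move=> g _; split=> //; rewrite /f t0_lift -mulmxA vA.
have [E [f [fM fl [m abm fm]]]] := commutator_invariant liftM abA detA.
apply: (@reidemeister_infinite_of_invariant _ _ phi lift liftP K E
  (fun g => ab g = 0%R) f m) => //.
- split=> [|x y hx hy]; first exact: ab1.
  by rewrite abM abV hx hy subrr.
- move=> g /(derived_series_anti k2) gN _.
  apply: (@additive_on_derived_eq0 _ _ f 1) gN => x y /ab_derived hx /ab_derived hy.
  exact: fM.
- by move=> g g0; split; [rewrite abA g0 mul0mx|exact: fl].
(* The exponent sums of z are fixed by A, and 1 is not an eigenvalue of A. *)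
move=> x y z hx hy /abN; rewrite !(abM, abV) hx hy oppr0 add0r addr0 abA.
move=> /(congr1 (map_mx (intr : int -> K))).
rewrite map_mxB map_mxM map_mx0 -[X in (X - _)%R]mulmx1 -mulmxBr -/A' => zA.
apply: t0_eq0; apply/eqP; apply: contraNT det_neq0 => z0; apply/det0P.
exists (t0 z) => //; rewrite -opprB mulmxN.
by rewrite [X in (- X)%R]zA oppr0.
Qed.

End FreeSolvable.

Theorem theorem3p1 (r : nat) (hr : (1 < r)%N) :
  (exists f : free_solvable_group r 1 -> 'rV[int]_r,
     bijective f /\ {morph f : x y / (x * y)%g >-> (x + y)%R})
  /\ ~ R_infty (free_solvable_group r 1)
  /\ (forall k : nat, (2 <= k)%N -> R_infty (free_solvable_group r k)).
Proof.
split; first by exists (@ab_bar r); split; [exact: ab_bar_bij|exact: ab_barM].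
by split; [exact: abelianization_not_R_infty|exact: free_solvable_R_infty].
Qed.
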